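(* Let $A_t\in\mathbb{R}_{\geq 0}^{M\times N}$ for $t=1,\dots,T$ and $Y\in\mathbb{R}_{\geq 0}^{M\times T}$, and let $\lambda_B,\mu_B,\lambda_C,\mu_C,\tau\geq 0$. For $B\in\mathbb{R}_{\geq 0}^{N\times K}$, $C\in\mathbb{R}_{\geq 0}^{K\times T}$ define the cost function $$\mathcal{F}(B,C)=\sum_{t=1}^{T}\frac12\Vert A_t(BC)_{\bullet,t}-Y_{\bullet,t}\Vert_2^2+\lambda_C\Vert C\Vert_1+\frac{\mu_C}{2}\Vert C\Vert_F^2+\lambda_B\Vert B\Vert_1+\frac{\mu_B}{2}\Vert B\Vert_F^2+\frac{\tau}{2}\operatorname{TV}(B).$$ Then, for any initialisations $B^{[0]}\in\mathbb{R}_{>0}^{N\times K}$, $C^{[0]}\in\mathbb{R}_{>0}^{K\times T}$, the alternating update rules (for $d=0,1,2,\dots$) $$B^{[d+1]}=B^{[d]}\circ\frac{\sum_{t=1}^TA_t^\intercal Y_{\bullet,t}\cdot({C^{[d]}}^\intercal)_{t,\bullet}+\tau P(B^{[d]})\circ Z(B^{[d]})}{\sum_{t=1}^TA_t^\intercal A_t(B^{[d]}C^{[d]})_{\bullet,t}\cdot({C^{[d]}}^\intercal)_{t,\bullet}+\mu_BB^{[d]}+\lambda_B\mathbf{1}_{N\times K}+\tau B^{[d]}\circ P(B^{[d]})},$$ $$C^{[d+1]}_{\bullet,t}=C^{[d]}_{\bullet,t}\circ\frac{{B^{[d+1]}}^\intercal A_t^\intercal Y_{\bullet,t}}{{B^{[d+1]}}^\intercal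 A_t^\intercal A_t(B^{[d+1]}C^{[d]})_{\bullet,t}+\mu_CC^{[d]}_{\bullet,t}+\lambda_C\mathbf{1}_{K\times 1}}\qquad(t=1,\dots,T)$$ lead to a monotonic decrease of the cost function, i.e. $\mathcal{F}(B^{[d+1]},C^{[d+1]})\leq\mathcal{F}(B^{[d]},C^{[d]})$ for all $d\geq 0$.
   Context: $M,N,T,K$ are positive integers. For a matrix $M$, $M_{\bullet,t}$ denotes its $t$-th column and $M_{n,\bullet}$ its $n$-th row; the product of a column (an $N\times1$ matrix) with a row (a $1\times K$ matrix) is the $N\times K$ outer product. $\Vert\cdot\Vert_F$ is the Frobenius norm, $\Vert M\Vert_1=\sum_{ij}|M_{ij}|$. The symbol $\circ$ denotes the entrywise (Hadamard) product and the fractions of matrices/vectors are entrywise quotients; $\mathbf{1}_{M\times N}$ is the $M\times N$ matrix with all entries $1$. The strictly positive initialisation is imposed so that the divisions in the update rules are well defined. Smoothed isotropic total variation: the row indices $n\in\{1,\dots,N\}$ of $B$ represent pixels. For every $n$ a set $\mathcal{N}_n\subset\{1,\dots,N\}$ of indices of spatially neighbouring pixels is fixed (for instance, in two dimensions the neighbours $(1,0)$ and $(0,1)$ for the pixel $(0,0)$), and $\varepsilon_{\mathrm{TV}}>0$ is a fixed constant. For $B\in\mathbb{R}^{N\times K}$, $$\operatorname{TV}(B)=\sum_{k=1}^K\sum_{n=1}^N|\nabla_{nk}B|,\qquad |\nabla_{nk}B|=\sqrt{\varepsilon_{\mathrm{TV}}^2+\sum_{\ell\in\mathcal{N}_n}(B_{nk}-B_{\ell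 k})^2}.$$ The adjoint neighbourhood $\bar{\mathcal{N}}_n$ is defined by $\ell\in\bar{\mathcal{N}}_n\Leftrightarrow n\in\mathcal{N}_\ell$. The matrices $P(B),Z(B)\in\mathbb{R}_{\geq0}^{N\times K}$ are $$P(B)_{nk}=\frac{1}{|\nabla_{nk}B|}\sum_{\ell\in\mathcal{N}_n}1+\sum_{\ell\in\bar{\mathcal{N}}_n}\frac{1}{|\nabla_{\ell k}B|},$$ $$Z(B)_{nk}=\frac{1}{P(B)_{nk}}\left(\frac{1}{|\nabla_{nk}B|}\sum_{\ell\in\mathcal{N}_n}\frac{B_{nk}+B_{\ell k}}{2}+\sum_{\ell\in\bar{\mathcal{N}}_n}\frac{B_{nk}+B_{\ell k}}{2|\nabla_{\ell k}B|}\right).$$ *)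

(* Defs.v *)
From mathcomp Require Import all_boot all_order all_algebra.
From mathcomp Require Import reals.
Set Implicit Arguments.
Unset Strict Implicit.
Unset Printing Implicit Defensive.
Import Order.TTheory GRing.Theory Num.Theory.
Local Open Scope ring_scope.

Section MatrixOperations.
Variable R : realType.

Definition frob_norm m n (X : 'M[R]_(m, n)) : R :=
  Num.sqrt (\sum_(i < m) \sum_(j < n) X i j ^+ 2).

Definition l2_norm m (v : 'cV[R]_m) : R := Num.sqrt (\sum_(i < m) v i 0 ^+ 2).

(* The entrywise sum of absolute values, not the operator norm. *)
Definition l1_norm m n (X : 'M[R]_(m, n)) : R :=
  \sum_(i < m) \sum_(j < n) `|X i j|.

Definition hadamard m n (X Y : 'M[R]_(m, n)) : 'M[R]_(m, n) :=
  \matrix_(i, j) (X i j * Y i j).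

(* Division is total: an entry with denominator 0 is 0. *)
Definition hadamard_div m n (X Y : 'M[R]_(m, n)) : 'M[R]_(m, n) :=
  \matrix_(i, j) (X i j / Y i j).

End MatrixOperations.

Section TotalVariation.
Variables (R : realType) (N K : nat) (eps : R) (nbh : 'I_N -> {set 'I_N}).
Implicit Type B : 'M[R]_(N, K).

Definition adj_nbh (n : 'I_N) : {set 'I_N} := [set l | n \in nbh l].

Definition grad_abs B (n : 'I_N) (k : 'I_K) : R :=
  Num.sqrt (eps ^+ 2 + \sum_(l in nbh n) (B n k - B l k) ^+ 2).

Definition TV B : R := \sum_(k < K) \sum_(n < N) grad_abs B n k.

Definition TV_P B : 'M[R]_(N, K) := \matrix_(n, k)
  ((grad_abs B n k)^-1 * (\sum_(l in nbh n) 1)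
   + \sum_(l in adj_nbh n) (grad_abs B l k)^-1).

(* If nbh n and adj_nbh n are both empty then TV_P B n k = 0 and the prefactor
   is 0^-1 = 0; only the product of TV_P B and TV_Z B enters the update. *)
Definition TV_Z B : 'M[R]_(N, K) := \matrix_(n, k)
  ((TV_P B n k)^-1 *
   ((grad_abs B n k)^-1 * (\sum_(l in nbh n) (B n k + B l k) / 2)
    + \sum_(l in adj_nbh n) (B n k + B l k) / (2 * grad_abs B l k))).

End TotalVariation.

Section Model.
Variables (R : realType) (M N T K : nat).
Variables (A : 'I_T -> 'M[R]_(M, N)) (Y : 'M[R]_(M, T)).
Implicit Types (B : 'M[R]_(N, K)) (C : 'M[R]_(K, T)).

Definition cost (lambdaB muB lambdaC muC tau eps : R)
    (nbh : 'I_N -> {set 'I_N}) B C : R :=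
  \sum_(t < T) 2^-1 * l2_norm (A t *m col t (B *m C) - col t Y) ^+ 2
  + lambdaC * l1_norm C + muC / 2 * frob_norm C ^+ 2
  + lambdaB * l1_norm B + muB / 2 * frob_norm B ^+ 2
  + tau / 2 * TV eps nbh B.

Definition update_B (lambdaB muB tau eps : R) (nbh : 'I_N -> {set 'I_N}) B C :
    'M[R]_(N, K) :=
  hadamard B (hadamard_div
    (\sum_(t < T) (A t)^T *m col t Y *m row t C^T
     + tau *: hadamard (TV_P eps nbh B) (TV_Z eps nbh B))
    (\sum_(t < T) (A t)^T *m A t *m col t (B *m C) *m row t C^T
     + muB *: B + lambdaB *: const_mx 1
     + tau *: hadamard B (TV_P eps nbh B))).

Definition update_C_col (lambdaC muC : R) B C (t : 'I_T) : 'cV[R]_K :=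
  hadamard (col t C) (hadamard_div
    (B^T *m (A t)^T *m col t Y)
    (B^T *m (A t)^T *m A t *m col t (B *m C)
     + muC *: col t C + lambdaC *: const_mx 1)).

End Model.

(* Main.v *)
(* Majorization-minimization. For x = b r the cost is bounded by its value at b plus
   sum_j b_j (D_j (r_j^2 - 1) / 2 - q_j (r_j - 1)), where q_j and D_j are the numerator
   and the denominator of the multiplicative update: the least-squares term is separated
   by Cauchy-Schwarz, the l1 norm is bounded by r - 1 <= (r^2 - 1) / 2, and the square
   roots in TV are replaced by their tangents, after which the squared differences are
   separated around the midpoints of the old values. The choice r_j = q_j / D_j
   minimizes this bound. Parametrizing by r keeps entries that have become 0 harmless,
   and where D_j = 0 but b_j > 0 also q_j = 0, so the convention q / 0 = 0 does no harm. *)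
Require Import Defs.
From mathcomp Require Import all_boot all_order all_algebra.
From mathcomp Require Import reals ring lra.
Import Order.TTheory GRing.Theory Num.Theory.
Local Open Scope ring_scope.

Set Implicit Arguments.
Unset Strict Implicit.
Unset Printing Implicit Defensive.

(** * Scalar inequalities and the separable least-squares surrogate *)

Section Majorization.
Variable R : realType.

(** Lagrange's identity: the double sum of [w i * w j * (r i - r j) ^+ 2] is twice the difference of
    the two sides. *)
Lemma cauchy_schwarz_weighted (J : finType) (w r : J -> R) :
  (forall j, 0 <= w j) ->
  (\sum_j w j * r j) ^+ 2 <= (\sum_j w j) * (\sum_j w j * r j ^+ 2).
Proof.
move=> w0; set S := \sum_j w j; set V := \sum_j w j * r j.
set Q := \sum_j w j * r j ^+ 2.
have : 0 <= \sum_i \sum_j w i * w j * (r i - r j) ^+ 2.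
  by apply: sumr_ge0 => i _; apply: sumr_ge0 => j _; rewrite mulr_ge0 ?sqr_ge0 ?mulr_ge0.
have -> : \sum_i \sum_j w i * w j * (r i - r j) ^+ 2
    = Q * S - V * V *+ 2 + S * Q.
  rewrite /Q /S /V !big_distrlr -sumrMnl -sumrB -big_split; apply: eq_bigr => i _.
  rewrite -sumrMnl -sumrB -big_split; apply: eq_bigr => j _ /=.
  by ring.
by move=> h; lra.
Qed.

(** Multiplied by [Num.sqrt b], this is [0 <= (Num.sqrt a - Num.sqrt b) ^+ 2]. *)
Lemma sqrtr_le_tangent (a b : R) : 0 <= a -> 0 < b ->
  Num.sqrt a <= Num.sqrt b + (Num.sqrt b)^-1 * ((a - b) / 2).
Proof.
move=> a0 b0; have s0 : 0 < Num.sqrt b by rewrite sqrtr_gt0.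
rewrite -[b in (a - b)](sqr_sqrtr (ltW b0)) -(ler_pM2l s0) mulrDr mulVKf ?gt_eqF//.
have := sqr_ge0 (Num.sqrt a - Num.sqrt b).
have := sqr_sqrtr a0.
by nra.
Qed.

(* The surrogate of Lee and Seung: the square of [\sum_j a i j * (b j * r j)] is
   separated by Cauchy-Schwarz with weights [a i j * b j]. *)
Lemma least_squares_majorization (I J : finType) (a : I -> J -> R) (y : I -> R)
    (b r : J -> R) :
  (forall i j, 0 <= a i j) -> (forall j, 0 <= b j) ->
  \sum_i 2^-1 * (\sum_j a i j * (b j * r j) - y i) ^+ 2
  <= \sum_i 2^-1 * (\sum_j a i j * b j - y i) ^+ 2
   + \sum_j b j * (2^-1 * (\sum_i a i j * (\sum_l a i l * b l)) * (r j ^+ 2 - 1)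
                   - (\sum_i a i j * y i) * (r j - 1)).
Proof.
move=> a0 b0.
have -> : \sum_j b j * (2^-1 * (\sum_i a i j * (\sum_l a i l * b l)) * (r j ^+ 2 - 1)
                   - (\sum_i a i j * y i) * (r j - 1))
  = \sum_i (2^-1 * (\sum_j a i j * b j) * (\sum_j a i j * b j * r j ^+ 2 - \sum_j a i j * b j)
        - y i * (\sum_j a i j * (b j * r j) - \sum_j a i j * b j)).
  under eq_bigr => j _.
    rewrite mulrBr [2^-1 * _]mulr_sumr !mulr_suml !mulr_sumr -sumrB; over.
  rewrite exchange_big; apply: eq_bigr => i _ /=.
  rewrite -!sumrB -mulrA [_ * (\sum_j (_ * _ ^+ 2 - _))]mulr_sumr !mulr_sumr -sumrB.
  apply: eq_bigr => j _ /=.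
  by ring.
rewrite -big_split; apply: ler_sum => i _ /=.
have := @cauchy_schwarz_weighted J (fun j => a i j * b j) r
  (fun j => mulr_ge0 (a0 i j) (b0 j)).
have -> : \sum_j a i j * (b j * r j) = \sum_j a i j * b j * r j.
  by apply: eq_bigr => j _; rewrite mulrA.
(* The terms in [y i] and [S ^+ 2] cancel, which leaves [V ^+ 2 <= S * Q]. *)
set V := \sum_j _; set S := \sum_j _; set Q := \sum_j _.
by nra.
Qed.

(** Every summand of the vanishing sum is zero, so for each [i] either [a i j = 0] or the inner sum
    vanishes, and then [a i j * b j = 0]. *)
Lemma least_squares_degenerate (I J : finType) (a : I -> J -> R) (y : I -> R)
    (b : J -> R) (j : J) :
  (forall i j, 0 <= a i j) -> (forall j, 0 <= b j) ->
  \sum_i a i j * (\sum_l a i l * b l) = 0 -> b j * (\sum_i a i j * y i) = 0.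
Proof.
move=> a0 b0 /eqP; rewrite psumr_eq0; last first.
  by move=> i _; apply: mulr_ge0 => //; apply: sumr_ge0 => l _; apply: mulr_ge0.
move=> /allP h; rewrite mulr_sumr big1 // => i _; apply/eqP.
have := h i (mem_index_enum i); rewrite implyTb mulf_eq0 => /orP[/eqP->|].
  by rewrite mul0r mulr0.
rewrite psumr_eq0; last by move=> l _; apply: mulr_ge0.
move=> /allP/(_ j (mem_index_enum j)); rewrite implyTb mulf_eq0 mulrA.
by case/orP => /eqP->; rewrite ?mulr0 ?mul0r.
Qed.

(* [q / D] minimizes the surrogate when [D != 0]; otherwise it is the junk value [0],
   and the surrogate is constant. *)
Lemma surrogate_step_le0 (b D q : R) : 0 <= b -> 0 <= D -> (D = 0 -> b * q = 0) ->
  b * (2^-1 * D * ((q / D) ^+ 2 - 1) - q * (q / D - 1)) <= 0.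
Proof.
move=> b0 D0 degen; have [D_eq0|D_neq0] := eqVneq D 0.
  by rewrite D_eq0 mulr0 mul0r sub0r mulrN mulrA degen// mul0r oppr0.
have -> : b * (2^-1 * D * ((q / D) ^+ 2 - 1) - q * (q / D - 1))
    = - (2^-1 * (b * D) * (q / D - 1) ^+ 2) by field.
by rewrite oppr_le0 mulr_ge0 ?sqr_ge0// mulr_ge0 ?invr_ge0// mulr_ge0.
Qed.

Lemma sub1_le_half_sqrB1 (r : R) : r - 1 <= 2^-1 * (r ^+ 2 - 1).
Proof. by have := sqr_ge0 (r - 1); nra. Qed.

End Majorization.

(** * Quadratic majorant of the smoothed total variation *)

Section TotalVariation.
Variables (R : realType) (N K : nat) (eps : R) (nbh : 'I_N -> {set 'I_N}).
Hypothesis eps_gt0 : 0 < eps.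
Implicit Type B X : 'M[R]_(N, K).

Lemma grad_abs_gt0 B n k : 0 < grad_abs eps nbh B n k.
Proof.
rewrite sqrtr_gt0 ltr_pwDl ?exprn_gt0//.
by apply: sumr_ge0 => l _; apply: sqr_ge0.
Qed.

Lemma TV_P_ge0 B n k : 0 <= TV_P eps nbh B n k.
Proof.
have g0 l : 0 <= (grad_abs eps nbh B l k)^-1 by rewrite invr_ge0 ltW ?grad_abs_gt0.
by rewrite mxE addr_ge0 ?mulr_ge0 ?sumr_ge0.
Qed.

(** If [TV_P] vanishes at the entry, positivity of the reciprocals makes both neighbourhoods empty,
    and both sides are 0. *)
Lemma TV_PM_Z B n k : TV_P eps nbh B n k * TV_Z eps nbh B n k =
  (grad_abs eps nbh B n k)^-1 * (\sum_(l in nbh n) (B n k + B l k) / 2)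
  + \sum_(l in adj_nbh nbh n) (grad_abs eps nbh B l k)^-1 * ((B n k + B l k) / 2).
Proof.
have g_gt0 l : 0 < (grad_abs eps nbh B l k)^-1 by rewrite invr_gt0 grad_abs_gt0.
have divE l : (B n k + B l k) / (2 * grad_abs eps nbh B l k)
    = (grad_abs eps nbh B l k)^-1 * ((B n k + B l k) / 2).
  by rewrite invfM mulrA mulrC.
rewrite [TV_Z _ _ _ _ _]mxE; under [X in _ * (_ * (_ + X))]eq_bigr do rewrite divE.
have [P0|P_neq0] := eqVneq (TV_P eps nbh B n k) 0; last by rewrite mulVKf.
rewrite P0 mul0r; move: P0; rewrite mxE => /eqP.
rewrite paddr_eq0 ?mulr_ge0 ?sumr_ge0 ?(ltW (g_gt0 _))//; last first.
  by move=> l _; rewrite ltW.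
rewrite mulf_eq0 gt_eqF//= !psumr_eq0//; last by move=> l _; rewrite ltW.
move=> /andP[/allP nbh0 /allP adj0]; rewrite !big1 ?mulr0 ?addr0//.
  move=> l l_adj; have := adj0 l (mem_index_enum l).
  by rewrite l_adj gt_eqF.
move=> l l_nbh; have := nbh0 l (mem_index_enum l).
by rewrite l_nbh oner_eq0.
Qed.

Lemma TV_PM_Z_ge0 B n k : (forall n k, 0 <= B n k) ->
  0 <= TV_P eps nbh B n k * TV_Z eps nbh B n k.
Proof.
move=> B_ge0; rewrite TV_PM_Z addr_ge0 ?mulr_ge0 ?sumr_ge0 ?invr_ge0//.
- exact/ltW/grad_abs_gt0.
- by move=> l _; rewrite mulr_ge0 ?addr_ge0 ?invr_ge0.
by move=> l _; rewrite !mulr_ge0 ?addr_ge0 ?invr_ge0// ltW ?grad_abs_gt0.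
Qed.

(* Concavity of the square root, then
   [(s - t)^2 <= 2 (s - c)^2 + 2 (t - c)^2] with [c] the midpoint of the old values. *)
Lemma TV_majorization B X :
  TV eps nbh X <= TV eps nbh B
    + \sum_n \sum_k (TV_P eps nbh B n k * (X n k ^+ 2 - B n k ^+ 2)
        - 2 * (TV_P eps nbh B n k * TV_Z eps nbh B n k) * (X n k - B n k)).
Proof.
rewrite [\sum_n _]exchange_big -big_split /=; apply: ler_sum => k _.
set g := fun n => (grad_abs eps nbh B n k)^-1.
have g_ge0 n : 0 <= g n by rewrite invr_ge0 ltW ?grad_abs_gt0.
(* This is [(X n k - c) ^+ 2 - (B n k - c) ^+ 2] for the midpoint [c] of [B n k] and [B l k]. *)
pose h n l := (X n k ^+ 2 - B n k ^+ 2) - (B n k + B l k) * (X n k - B n k).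
have -> : \sum_n (TV_P eps nbh B n k * (X n k ^+ 2 - B n k ^+ 2)
        - 2 * (TV_P eps nbh B n k * TV_Z eps nbh B n k) * (X n k - B n k))
    = \sum_n \sum_(l in nbh n) g n * (h n l + h l n).
  under [RHS]eq_bigr => n _ do under eq_bigr => l _ do rewrite mulrDr.
  under [RHS]eq_bigr => n _ do rewrite big_split /=.
  (* Exchanging the sums over [h l n] collects at each pixel the terms of those pixels that have it
     as a neighbour, hence [adj_nbh]. *)
  rewrite [RHS]big_split /= [X in _ = _ + X](exchange_big_dep xpredT) //= -big_split /=.
  apply: eq_bigr => n _; rewrite TV_PM_Z mxE -/(g n).
  have adjE F : \sum_(l | n \in nbh l) F l = \sum_(l in adj_nbh nbh n) F l :> R.
    by apply: eq_bigl => l; rewrite inE.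
  rewrite adjE.
  set s1 := \sum_(l in nbh n) 1; set s2 := \sum_(l in adj_nbh nbh n) _^-1.
  set t1 := \sum_(l in nbh n) _; set t2 := \sum_(l in adj_nbh nbh n) _^-1 * _.
  transitivity ((g n * s1 * (X n k ^+ 2 - B n k ^+ 2) - 2 * (g n * t1) * (X n k - B n k))
    + (s2 * (X n k ^+ 2 - B n k ^+ 2) - 2 * t2 * (X n k - B n k))); first by ring.
  congr (_ + _).
    rewrite /s1 /t1 !mulr_sumr !mulr_suml -sumrB; apply: eq_bigr => l _.
    by rewrite /h; field.
  rewrite /s2 /t2 !mulr_sumr !mulr_suml -sumrB; apply: eq_bigr => l _.
  by rewrite /h -/(g l); field.
rewrite -big_split /=; apply: ler_sum => n _.
have g2_gt0 : 0 < eps ^+ 2 + \sum_(l in nbh n) (B n k - B l k) ^+ 2.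
  by rewrite -sqrtr_gt0 grad_abs_gt0.
apply: (le_trans (sqrtr_le_tangent _ g2_gt0)).
  by rewrite addr_ge0 ?sqr_ge0 ?sumr_ge0// => l _; apply: sqr_ge0.
rewrite -/(grad_abs eps nbh B n k) -/(g n) lerD2l -mulr_sumr ler_wpM2l //.
rewrite opprD addrACA subrr add0r -sumrB mulr_suml; apply: ler_sum => l _.
rewrite /h.
(* Half of this square is exactly the gap between the two sides. *)
have := sqr_ge0 ((X n k - B n k) + (X l k - B l k)).
by nra.
Qed.

End TotalVariation.

(** * Multiplicative updates for penalized nonnegative least squares *)

Section MultiplicativeUpdate.
Variables (R : realType) (I J : finType) (a : I -> J -> R) (y : I -> R).
Variables (lambda mu tau : R).
Hypotheses (a_ge0 : forall i j, 0 <= a i j) (lambda_ge0 : 0 <= lambda).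
Hypotheses (mu_ge0 : 0 <= mu) (tau_ge0 : 0 <= tau).

(** The index [j] runs over all entries of [B], or over one column of [C]. The plain sum stands for
    the l1 norm of a nonnegative [x]. *)
Definition penalized_ls (x : J -> R) : R :=
  \sum_i 2^-1 * (\sum_j a i j * x j - y i) ^+ 2
  + lambda * \sum_j x j + mu / 2 * \sum_j x j ^+ 2.

(* [p] and [z] come from the quadratic majorant
   [tau * \sum_j (p j / 2 * x j ^+ 2 - p j * z j * x j)] of the total variation in the
   [B] update; the [C] update is the case [tau = 0]. *)
Definition update_factor (p z b : J -> R) (j : J) : R :=
  (\sum_i a i j * y i + tau * (p j * z j))
  / (\sum_i a i j * (\sum_l a i l * b l) + mu * b j + lambda + tau * (b j * p j)).

(** The [tau] term is the change of the quadratic majorant; a bound of the total variation by it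
    yields descent of the full cost. *)
Lemma penalized_ls_descent (p z b x : J -> R) :
  (forall j, 0 <= p j) -> (forall j, 0 <= b j) ->
  (forall j, x j = b j * update_factor p z b j) ->
  penalized_ls x + tau * \sum_j (2^-1 * (p j * (x j ^+ 2 - b j ^+ 2))
                                 - p j * z j * (x j - b j))
    <= penalized_ls b.
Proof.
move=> p_ge0 b_ge0 xE; set r := update_factor p z b in xE.
set s := fun j => \sum_i a i j * (\sum_l a i l * b l).
have s_ge0 j : 0 <= s j.
  by apply: sumr_ge0 => i _; rewrite mulr_ge0 ?sumr_ge0// => l _; rewrite mulr_ge0.
pose D j := s j + mu * b j + lambda + tau * (b j * p j).
pose q j := \sum_i a i j * y i + tau * (p j * z j).
have step_le0 j : b j * (2^-1 * D j * (r j ^+ 2 - 1) - q j * (r j - 1)) <= 0.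
  have mub_ge0 : 0 <= mu * b j by rewrite mulr_ge0.
  have tbp_ge0 : 0 <= tau * (b j * p j) by rewrite !mulr_ge0.
  apply: surrogate_step_le0 => //.
    by rewrite !addr_ge0.
  (* All four nonnegative parts of [D j] vanish: [s0] kills the data part of [b j * q j], and [tbp0]
     the rest. *)
  move=> /eqP; rewrite !paddr_eq0 ?addr_ge0// -!andbA => /and4P[/eqP s0 _ _ /eqP tbp0].
  rewrite mulrDr least_squares_degenerate// add0r.
  have -> : b j * (tau * (p j * z j)) = tau * (b j * p j) * z j by ring.
  by rewrite tbp0 mul0r.
have ls := @least_squares_majorization R I J a y b r a_ge0 b_ge0.
rewrite /penalized_ls.
under eq_bigr do under eq_bigr do rewrite xE.
rewrite -!addrA (le_trans (lerD ls (lexx _)))// -addrA lerD2l.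
rewrite !mulr_sumr -!big_split; apply: ler_sum => j _ /=; rewrite xE.
have l1 : lambda * b j * (r j - 1) <= lambda * b j * (2^-1 * (r j ^+ 2 - 1)).
  by rewrite ler_wpM2l ?mulr_ge0 ?sub1_le_half_sqrB1.
have := step_le0 j; rewrite /D /q -/(s j).
by lra.
Qed.

Lemma update_factor_ge0 (p z b : J -> R) (j : J) :
  (forall i, 0 <= y i) -> (forall j, 0 <= p j) -> (forall j, 0 <= p j * z j) ->
  (forall j, 0 <= b j) -> 0 <= update_factor p z b j.
Proof.
move=> y_ge0 p_ge0 pz_ge0 b_ge0; apply: divr_ge0.
  by rewrite addr_ge0 ?(mulr_ge0 tau_ge0)// sumr_ge0// => i _; rewrite mulr_ge0.
rewrite !addr_ge0 ?mulr_ge0// sumr_ge0// => i _; rewrite mulr_ge0//.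
by rewrite sumr_ge0// => l _; rewrite mulr_ge0.
Qed.

End MultiplicativeUpdate.

(** * Norms as plain sums *)

Section Norms.
Variable R : realType.

Lemma sqr_l2_norm m (v : 'cV[R]_m) : l2_norm v ^+ 2 = \sum_i v i 0 ^+ 2.
Proof. by rewrite sqr_sqrtr// sumr_ge0// => i _; apply: sqr_ge0. Qed.

Lemma sqr_frob_norm m n (X : 'M[R]_(m, n)) :
  frob_norm X ^+ 2 = \sum_i \sum_j X i j ^+ 2.
Proof.
by rewrite sqr_sqrtr// sumr_ge0// => i _; rewrite sumr_ge0// => j _; apply: sqr_ge0.
Qed.

Lemma l1_norm_ge0E m n (X : 'M[R]_(m, n)) :
  (forall i j, 0 <= X i j) -> l1_norm X = \sum_i \sum_j X i j.
Proof. by move=> X0; do 2!(apply: eq_bigr => ? _); rewrite ger0_norm. Qed.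

End Norms.

(** * Descent of the two matrix half-steps *)

Section Descent.
Variables (R : realType) (M N T K : nat).
Variables (nbh : 'I_N -> {set 'I_N}) (eps : R).
Hypothesis eps_gt0 : 0 < eps.
Variables (A : 'I_T -> 'M[R]_(M, N)) (Y : 'M[R]_(M, T)).
Hypotheses (A_ge0 : forall t m n, 0 <= A t m n) (Y_ge0 : forall m t, 0 <= Y m t).
Variables (lambdaB muB lambdaC muC tau : R).
Hypotheses (lambdaB_ge0 : 0 <= lambdaB) (muB_ge0 : 0 <= muB).
Hypotheses (lambdaC_ge0 : 0 <= lambdaC) (muC_ge0 : 0 <= muC) (tau_ge0 : 0 <= tau).
Variables (B : 'M[R]_(N, K)) (C : 'M[R]_(K, T)).
Hypotheses (B_ge0 : forall n k, 0 <= B n k) (C_ge0 : forall k t, 0 <= C k t).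

Local Notation cost := (cost A Y lambdaB muB lambdaC muC tau eps nbh).
Local Notation B' := (update_B A Y lambdaB muB tau eps nbh B C).

(** For fixed [C], [aB] is the matrix of the linear map from the entries of [B] to all predicted
    data. For fixed [B] the columns of [C] decouple, so [aC] is a separate matrix for each [t]. *)
Let aB (i : 'I_T * 'I_M) (j : 'I_N * 'I_K) : R := A i.1 i.2 j.1 * C j.2 i.1.
Let yB (i : 'I_T * 'I_M) : R := Y i.2 i.1.
Let aC (t : 'I_T) (m : 'I_M) (k : 'I_K) : R := (A t *m B) m k.

Lemma forward_B_E (X : 'M[R]_(N, K)) t m :
  (A t *m col t (X *m C)) m 0 = \sum_j aB (t, m) j * X j.1 j.2.
Proof.
rewrite mxE -(pair_bigA _ (fun n k => aB (t, m) (n, k) * X n k)) /=.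
apply: eq_bigr => n _; rewrite !mxE mulr_sumr; apply: eq_bigr => k _.
by rewrite -mulrA [C _ _ * _]mulrC.
Qed.

Lemma forward_C_E (X : 'M[R]_(K, T)) t m :
  (A t *m col t (B *m X)) m 0 = \sum_k aC t m k * X k t.
Proof.
by rewrite colE -!mulmxA mulmxA -colE mxE; apply: eq_bigr => k _; rewrite [col _ _ _ _]mxE.
Qed.

Lemma update_B_E n k : B' n k = B n k * update_factor aB yB lambdaB muB tau
  (fun j => TV_P eps nbh B j.1 j.2) (fun j => TV_Z eps nbh B j.1 j.2)
  (fun j => B j.1 j.2) (n, k).
Proof.
rewrite /update_factor -(pair_bigA _ (fun t m => aB (t, m) (n, k) * Y m t)).
rewrite -(pair_bigA _ (fun t m => aB (t, m) (n, k) * (\sum_l aB (t, m) l * B l.1 l.2))).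
rewrite [LHS]mxE [hadamard_div _ _ _ _]mxE; congr (_ * (_ / _)).
  rewrite [LHS]mxE summxE; congr (_ + _); last by rewrite [LHS]mxE [hadamard _ _ _ _]mxE.
  apply: eq_bigr => t _; rewrite mxE big_ord1 !mxE mulr_suml; apply: eq_bigr => m _.
  by rewrite !mxE mulrAC.
rewrite [LHS]mxE [X in X + _]mxE [X in X + _ + _]mxE summxE.
rewrite [(muB *: B) _ _]mxE [(lambdaB *: const_mx 1) n k]mxE [const_mx _ _ _]mxE mulr1.
rewrite [X in _ + X]mxE [hadamard _ _ _ _]mxE; congr (_ + _ + _ + _).
apply: eq_bigr => t _; rewrite mxE big_ord1 -mulmxA mxE !mxE mulr_suml.
apply: eq_bigr => m _.
by rewrite forward_B_E !mxE mulrAC.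
Qed.

Lemma update_C_E k t : update_C_col A Y lambdaC muC B C t k 0 =
  C k t * update_factor (aC t) (Y^~ t) lambdaC muC 0 (fun=> 0) (fun=> 0) (C^~ t) k.
Proof.
rewrite /update_factor !mul0r !addr0.
rewrite [LHS]mxE [hadamard_div _ _ _ _]mxE -trmx_mul [col t C k 0]mxE; congr (_ * (_ / _)).
  by rewrite mxE; apply: eq_bigr => m _; rewrite [_^T _ _]mxE [col _ _ _ _]mxE.
rewrite [LHS]mxE [X in X + _]mxE [(muC *: col t C) k 0]mxE [(lambdaC *: const_mx 1) k 0]mxE.
rewrite [col t C k 0]mxE [const_mx _ _ _]mxE mulr1; congr (_ + _ + _).
rewrite -mulmxA mxE; apply: eq_bigr => m _.
by rewrite forward_C_E mxE.
Qed.

Lemma aB_ge0 i j : 0 <= aB i j. Proof. exact: mulr_ge0. Qed.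

Lemma aC_ge0 t m k : 0 <= aC t m k.
Proof. by rewrite /aC mxE sumr_ge0// => n _; rewrite mulr_ge0. Qed.

Lemma update_B_ge0 n k : 0 <= B' n k.
Proof.
rewrite update_B_E mulr_ge0// update_factor_ge0//.
- exact: aB_ge0.
- by move=> i; apply: Y_ge0.
- by move=> j; apply: TV_P_ge0.
by move=> j; apply: TV_PM_Z_ge0.
Qed.

Lemma update_C_ge0 k t : 0 <= update_C_col A Y lambdaC muC B C t k 0.
Proof.
by rewrite update_C_E mulr_ge0// update_factor_ge0//= ?mul0r//; apply: aC_ge0.
Qed.

Lemma cost_B_E (X : 'M[R]_(N, K)) : (forall n k, 0 <= X n k) ->
  cost X C = penalized_ls aB yB lambdaB muB (fun j => X j.1 j.2)
    + lambdaC * l1_norm C + muC / 2 * frob_norm C ^+ 2 + tau / 2 * TV eps nbh X.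
Proof.
move=> X_ge0; rewrite /cost /penalized_ls.
have -> : \sum_t 2^-1 * l2_norm (A t *m col t (X *m C) - col t Y) ^+ 2
    = \sum_i 2^-1 * (\sum_j aB i j * X j.1 j.2 - yB i) ^+ 2.
  rewrite -(pair_bigA _ (fun t m =>
    2^-1 * (\sum_j aB (t, m) j * X j.1 j.2 - yB (t, m)) ^+ 2)).
  apply: eq_bigr => t _; rewrite sqr_l2_norm mulr_sumr; apply: eq_bigr => m _.
  by rewrite [X in X ^+ 2]mxE forward_B_E !mxE.
rewrite (sqr_frob_norm X) (l1_norm_ge0E X_ge0) [X in lambdaB * X]pair_bigA.
rewrite [X in muB / 2 * X]pair_bigA /=.
by ring.
Qed.

Lemma cost_C_E (X : 'M[R]_(K, T)) : (forall k t, 0 <= X k t) ->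
  cost B X = \sum_t penalized_ls (aC t) (Y^~ t) lambdaC muC (X^~ t)
    + lambdaB * l1_norm B + muB / 2 * frob_norm B ^+ 2 + tau / 2 * TV eps nbh B.
Proof.
move=> X_ge0; rewrite /cost /penalized_ls; do 3!congr (_ + _).
rewrite (sqr_frob_norm X) (l1_norm_ge0E X_ge0).
rewrite [X in lambdaC * X]exchange_big [X in muC / 2 * X]exchange_big.
rewrite [lambdaC * _]mulr_sumr [muC / 2 * _]mulr_sumr -!big_split /=.
apply: eq_bigr => t _; congr (_ + _ + _).
rewrite sqr_l2_norm mulr_sumr; apply: eq_bigr => m _.
by rewrite [X in X ^+ 2]mxE forward_C_E !mxE.
Qed.

Lemma update_B_descent : cost B' C <= cost B C.
Proof.
have B'_ge0 := update_B_ge0.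
rewrite !cost_B_E//; set p := fun j : 'I_N * 'I_K => TV_P eps nbh B j.1 j.2.
set z := fun j : 'I_N * 'I_K => TV_Z eps nbh B j.1 j.2.
have := @penalized_ls_descent R _ _ aB yB lambdaB muB tau aB_ge0 lambdaB_ge0
  muB_ge0 tau_ge0 p z (fun j => B j.1 j.2) (fun j => B' j.1 j.2).
move=> /(_ (fun j => TV_P_ge0 _ eps_gt0 _ _ _) (fun j => B_ge0 _ _)).
have xE j : B' j.1 j.2 = B j.1 j.2 *
  update_factor aB yB lambdaB muB tau p z (fun j => B j.1 j.2) j.
  by rewrite update_B_E -surjective_pairing.
move=> /(_ xE).
have := TV_majorization nbh eps_gt0 B B'; rewrite pair_bigA /=.
set S := \sum_j _; set S' := \sum_j _ => tv.
(* The half matches the weight [tau / 2] of [TV] in the cost. *)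
have -> : S' = 2^-1 * S.
  by rewrite /S mulr_sumr; apply: eq_bigr => j _; rewrite /p /z; field.
have {}tv := ler_wpM2l tau_ge0 tv.
by lra.
Qed.

(** The cost is a sum over the columns of [C] up to a constant, and each column descends
    separately. *)
Lemma update_C_descent (C' : 'M[R]_(K, T)) :
  (forall t, col t C' = update_C_col A Y lambdaC muC B C t) ->
  cost B C' <= cost B C.
Proof.
move=> colE; have C'E k t : C' k t = update_C_col A Y lambdaC muC B C t k 0.
  by rewrite -colE mxE.
have C'_ge0 k t : 0 <= C' k t by rewrite C'E update_C_ge0.
rewrite !cost_C_E// -!addrA lerD2r; apply: ler_sum => t _.
have := @penalized_ls_descent R _ _ (aC t) (Y^~ t) lambdaC muC 0 (aC_ge0 t)
  lambdaC_ge0 muC_ge0 (lexx 0) (fun=> 0) (fun=> 0) (C^~ t) (C'^~ t).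
rewrite mul0r addr0; apply=> // k.
by rewrite C'E update_C_E.
Qed.

End Descent.

Theorem theorem2p2 (R : realType) (M N T K : nat)
  (M_gt0 : (0 < M)%N) (N_gt0 : (0 < N)%N) (T_gt0 : (0 < T)%N) (K_gt0 : (0 < K)%N)
  (nbh : 'I_N -> {set 'I_N}) (eps : R) (eps_gt0 : 0 < eps)
  (A : 'I_T -> 'M[R]_(M, N)) (A_ge0 : forall t m n, 0 <= A t m n)
  (Y : 'M[R]_(M, T)) (Y_ge0 : forall m t, 0 <= Y m t)
  (lambdaB muB lambdaC muC tau : R)
  (lambdaB_ge0 : 0 <= lambdaB) (muB_ge0 : 0 <= muB)
  (lambdaC_ge0 : 0 <= lambdaC) (muC_ge0 : 0 <= muC) (tau_ge0 : 0 <= tau)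
  (B : nat -> 'M[R]_(N, K)) (C : nat -> 'M[R]_(K, T))
  (B0_gt0 : forall n k, 0 < B 0%N n k) (C0_gt0 : forall k t, 0 < C 0%N k t)
  (B_rec : forall d : nat,
     B d.+1 = update_B A Y lambdaB muB tau eps nbh (B d) (C d))
  (C_rec : forall (d : nat) (t : 'I_T),
     col t (C d.+1) = update_C_col A Y lambdaC muC (B d.+1) (C d) t) :
  forall d : nat,
    cost A Y lambdaB muB lambdaC muC tau eps nbh (B d.+1) (C d.+1)
      <= cost A Y lambdaB muB lambdaC muC tau eps nbh (B d) (C d).
Proof.
(* A zero numerator can produce zero entries, so only nonnegativity is invariant. *)
have BC_ge0 d : (forall n k, 0 <= B d n k) /\ (forall k t, 0 <= C d k t).
  elim: d => [|d [B_ge0 C_ge0]]; first by split=> *; apply: ltW.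
  have B'_ge0 n k : 0 <= B d.+1 n k by rewrite B_rec; apply: update_B_ge0.
  split=> // k t; have -> : C d.+1 k t = col t (C d.+1) k 0 by rewrite mxE.
  by rewrite C_rec; apply: update_C_ge0.
move=> d; have [[B_ge0 C_ge0] [B'_ge0 _]] := (BC_ge0 d, BC_ge0 d.+1).
(* The rule for [C] already uses the new [B], so the intermediate point is [(B d.+1, C d)]. *)
apply: (@le_trans _ _ (cost A Y lambdaB muB lambdaC muC tau eps nbh (B d.+1) (C d))).
  exact: update_C_descent.
by rewrite B_rec; apply: update_B_descent.
Qed.
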